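(* Let $n,d,q,s\ge 1$ be integers, $\mathbf{x}_1,\dots,\mathbf{x}_n\in\mathbb{R}^d$, $\mathbf{y}\in\mathbb{R}^n$, $\lambda>0$, $\epsilon>0$ and $\delta\in(0,1)$. Let $\mathbf{K}\in\mathbb{R}^{n\times n}$ be the kernel matrix of the degree-$q$ homogeneous polynomial kernel $k(\mathbf{x},\mathbf{z})=(\mathbf{x}^T\mathbf{z})^q$, i.e. $\mathbf{K}_{ij}=k(\mathbf{x}_i,\mathbf{x}_j)$, and let $s_\lambda(\mathbf{K})=\mathrm{Tr}\left((\mathbf{K}+\lambda \mathbf{I}_n)^{-1}\mathbf{K}\right)$. Let $\varphi:\mathbb{R}^d\to\mathbb{R}^s$ be a random TensorSketch map of degree $q$, let $\mathbf{z}_i=\varphi(\mathbf{x}_i)\in\mathbb{R}^s$ for $i=1,\dots,n$, and let $\mathbf{Z}\in\mathbb{R}^{n\times s}$ have rows $\mathbf{z}_1^T,\dots,\mathbf{z}_n^T$. Let $\mathbf{c}$ be the exact solution of $(\mathbf{K}+\lambda \mathbf{I}_n)\mathbf{c}=\mathbf{y}$. Provided that $$s\ \ge\ 4(2+3^q)\,s_\lambda(\mathbf{K})^2/\delta,$$ with probability at least $1-\delta$, after $$T=\left\lceil \frac{\sqrt3}{2}\ln(2/\epsilon)\right\rceil$$ iterations of the preconditioned conjugate gradient method (PCG) on the system $(\mathbf{K}+\lambda \mathbf{I}_n)\mathbf{c}=\mathbf{y}$, starting from the all-zeros vector and with $\mathbf{Z}\mathbf{Z}^T+\lambda \mathbf{I}_n$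 as a preconditioner, one obtains a vector $\tilde{\mathbf{c}}$ such that $$\|\tilde{\mathbf{c}}-\mathbf{c}\|_{\mathbf{K}+\lambda \mathbf{I}_n}\le \epsilon\,\|\mathbf{c}\|_{\mathbf{K}+\lambda \mathbf{I}_n}.$$
   Context: For a symmetric positive definite matrix $\mathbf{A}$, $\|\mathbf{x}\|_{\mathbf{A}}=\sqrt{\mathbf{x}^T\mathbf{A}\mathbf{x}}$. Write $[m]=\{1,\dots,m\}$. TensorSketch. Let $h_1,\dots,h_q:[d]\to[s]$ be $3$-wise independent (uniform) random hash functions and $g_1,\dots,g_q:[d]\to\{+1,-1\}$ be $4$-wise independent (uniform) random sign functions, all $2q$ functions chosen independently of each other. Define $H:[d]^q\to[s]$ and $G:[d]^q\to\{+1,-1\}$ by $$H(i_1,\dots,i_q)\equiv h_1(i_1)+h_2(i_2)+\cdots+h_q(i_q) \bmod s,\qquad G(i_1,\dots,i_q)=g_1(i_1)g_2(i_2)\cdots g_q(i_q),$$ where residues mod $s$ are identified with $[s]$. The TensorSketch matrix $\mathbf{S}\in\mathbb{R}^{s\times d^q}$ has columns indexed by $[d]^q$, and its column $(i_1,\dots,i_q)$ is $G(i_1,\dots,i_q)\,\mathbf{e}_{H(i_1,\dots,i_q)}$, with $\mathbf{e}_j$ the $j$-th standard basis vector of $\mathbb{R}^s$. Let $v_q:\mathbb{R}^d\to\mathbb{R}^{d^q}$ map $\mathbf{x}$ to the vector with entries $x_{i_1}x_{i_2}\cdots x_{i_q}$ indexed by $(i_1,\dots,i_q)\in[d]^q$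 (so $(\mathbf{x}^T\mathbf{z})^q=v_q(\mathbf{x})^Tv_q(\mathbf{z})$). The TensorSketch map is $\varphi(\mathbf{x})=\mathbf{S}v_q(\mathbf{x})$. The probability is over the choice of the hash and sign functions. PCG is considered in exact arithmetic. For a positive definite system $\mathbf{A}\mathbf{c}=\mathbf{y}$ with positive definite preconditioner $\mathbf{M}$ and zero initial vector, the $t$-th PCG iterate is the minimizer of $\|\mathbf{x}-\mathbf{c}\|_{\mathbf{A}}$ over $\mathbf{x}$ in the Krylov subspace $\mathrm{span}\{(\mathbf{M}^{-1}\mathbf{A})^j\mathbf{M}^{-1}\mathbf{y}: 0\le j<t\}$. (For $t\le 0$ the iterate is the zero initial vector.) *)

(* Defs.v *)
From HB Require Import structures.
From mathcomp Require Import all_boot all_order all_algebra.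
From mathcomp Require Import all_classical all_reals all_analysis.

Set Implicit Arguments.
Unset Strict Implicit.
Unset Printing Implicit Defensive.

Import Order.TTheory GRing.Theory Num.Theory.
Local Open Scope classical_set_scope.
Local Open Scope ring_scope.

Section RandomFunctions.
Context (R : realType) (dis : measure_display) (Omega : measurableType dis).
Variable P : probability Omega R.

Definition indep_upto (k : nat) (I : finType) (F : I -> set (set Omega)) :=
  forall (J : {set I}) (E : I -> set Omega), (#|J| <= k)%N ->
    (forall i, i \in J -> F i (E i)) ->
    P (\bigcap_(i in [set` J]) E i) = (\prod_(i in J) P (E i))%E.

Definition mutually_indep (I : finType) (F : I -> set (set Omega)) :=
  indep_upto #|I| F.

(* The sigma-algebra generated by X when T is finite. *)
Definition rv_events (T : Type) (X : Omega -> T) : set (set Omega) :=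
  [set X @^-1` A | A in [set: set T]].

Definition finite_rv (T : finType) (X : Omega -> T) :=
  forall a, measurable (X @^-1` [set a]).

(* Independence is required of every set of at most k points, so that the
   notion is still meaningful when the domain has fewer than k points. *)
Definition kwise_uniform (k : nat) (D T : finType)
    (h : Omega -> {ffun D -> T}) :=
  [/\ finite_rv h,
      forall (i : D) (a : T), P [set w | h w i = a] = (#|T|%:R^-1)%:E
    & indep_upto k (fun i : D => rv_events (fun w => h w i))].

(* A sign function is boolean-valued, b standing for the sign (-1) ^+ b. *)
Definition tensorsketch_functions (q d s : nat)
    (h : 'I_q -> Omega -> {ffun 'I_d -> 'I_s})
    (g : 'I_q -> Omega -> {ffun 'I_d -> bool}) :=
  [/\ forall k, kwise_uniform 3 (h k),
      forall k, kwise_uniform 4 (g k)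
    & mutually_indep (fun c : 'I_q + 'I_q =>
        match c with
        | inl k => rv_events (h k)
        | inr k => rv_events (g k)
        end)].

End RandomFunctions.

Section TensorSketch.
Variables (R : realType) (q d s : nat).

(* [d]^q; there are d ^ q multi-indices (card_ffun), and coordinates of
   R^(d^q) are numbered through enum_val. *)
Definition multi_index := {ffun 'I_q -> 'I_d}.

(* Buckets are labelled by the residues 0, ..., s - 1. *)
Definition sketch_hash (h : 'I_q -> {ffun 'I_d -> 'I_s}) (i : multi_index) :
  nat := ((\sum_(k < q) h k (i k)) %% s)%N.

Definition sketch_sign (g : 'I_q -> {ffun 'I_d -> bool}) (i : multi_index) :
  R := \prod_(k < q) (-1) ^+ g k (i k).

Definition tensorsketch_mx (h : 'I_q -> {ffun 'I_d -> 'I_s})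
    (g : 'I_q -> {ffun 'I_d -> bool}) : 'M[R]_(s, #|{: multi_index}|) :=
  \matrix_(j, c) (sketch_sign g (enum_val c)
                  * (sketch_hash h (enum_val c) == j :> nat)%:R).

Definition tensor_power (x : 'cV[R]_d) : 'cV[R]_#|{: multi_index}| :=
  \col_c \prod_(k < q) x ((enum_val c : multi_index) k) 0.

Definition tensorsketch (h : 'I_q -> {ffun 'I_d -> 'I_s})
    (g : 'I_q -> {ffun 'I_d -> bool}) (x : 'cV[R]_d) : 'cV[R]_s :=
  tensorsketch_mx h g *m tensor_power x.

End TensorSketch.

Section KernelRidge.
Variable R : realType.

Definition poly_kernel (q d : nat) (x z : 'cV[R]_d) : R :=
  (x^T *m z) 0 0 ^+ q.

Definition kernel_mx (n d : nat) (k : 'cV[R]_d -> 'cV[R]_d -> R)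
    (x : 'I_n -> 'cV[R]_d) : 'M[R]_n := \matrix_(i, j) k (x i) (x j).

Definition statistical_dim (n : nat) (lambda : R) (K : 'M[R]_n) : R :=
  \tr (invmx (K + lambda%:M) *m K).

Definition energy_norm (n : nat) (A : 'M[R]_n) (x : 'cV[R]_n) : R :=
  Num.sqrt ((x^T *m A *m x) 0 0).

(* The exponents j range over 0 <= j < t; in particular the subspace is
   trivial when the integer t is not positive. *)
Definition krylov (n : nat) (A M : 'M[R]_n) (y : 'cV[R]_n) (t : int) :
    {vspace 'cV[R]_n} :=
  <<[seq iter j (mulmx (invmx M *m A)) (invmx M *m y)
    | j <- iota 0 `|Num.max t 0|%N]>>%VS.

(* The t-th iterate in exact arithmetic, from the zero initial vector.  For A
   and M positive definite, invmx A *m y is the exact solution and the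
   minimizer is unique. *)
Definition is_pcg_iterate (n : nat) (A M : 'M[R]_n) (y : 'cV[R]_n) (t : int)
    (x : 'cV[R]_n) : Prop :=
  x \in krylov A M y t /\
  forall z, z \in krylov A M y t ->
    energy_norm A (x - invmx A *m y) <= energy_norm A (z - invmx A *m y).

End KernelRidge.

(* Main.v *)
Require Import Defs.
From HB Require Import structures.
From mathcomp Require Import all_boot all_order all_algebra.
From mathcomp Require Import all_classical all_reals all_analysis.
From mathcomp Require Import ring lra.

Set Implicit Arguments.
Unset Strict Implicit.
Unset Printing Implicit Defensive.

Import Order.TTheory GRing.Theory Num.Theory.
Local Open Scope classical_set_scope.
Local Open Scope ring_scope.

(** Write A = K + lambda I, let Phi be the matrix whose rows are the tensor
    powers of the data points, so that K = Phi Phi^T, and let S be the sketching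
    matrix, so that the preconditioner is M = Phi S^T S Phi^T + lambda I.

    Whitening.  Put F = [Phi | sqrt(lambda) I], so A = F F^T, and
    W = F^T A^-1, so W^T W = A^-1 and W^T F^T = I.  This factorization plays the
    part of A^(-1/2) without any spectral theory.  The whitened features
    X = W Phi satisfy |X|_F^2 = tr (A^-1 K) = s_lambda(K), and
    W (M - A) W^T = X S^T S X^T - X X^T is the error of sketching the Gram
    matrix of the rows of X.

    Sketching error.  For fixed vectors u, v the error of the sketched inner
    product is the sum over multi-indices i <> j of u_i v_j G(i) G(j) [H i = H j].
    In its second moment, indexed by (i, j, k, l), the signs leave only the
    terms in which at every coordinate the four indices form two equal pairs,
    and a collision of i <> j has probability at most 1/s; summing the pairings
    coordinate by coordinate ([sum_prod_pairings_le]) gives the bound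
    3^q / s |u|^2 |v|^2 ([sketch_dot_moment]).  Hence the expected squared
    Frobenius norm of W (M - A) W^T is at most 3^q / s s_lambda(K)^2, and
    Markov's inequality shows that this norm is at most 1/2 with probability
    at least 1 - delta.

    Convergence.  When it is at most 1/2, the spectrum of M^-1 A lies in
    [2/3, 2], which is used in the form that C = 2 - (3/2) M^-1 A is a
    contraction in the A-norm ([whitened_contraction]).  The Pell identity
    T_k^2 + (1 - C^2) U_(k-1)^2 = 1 of the Chebyshev polynomials then bounds
    T_k(C) by 1 ([cheb_energy_le]); as C = 2 where M^-1 A = 0, the vector
    c - T_k(C) c / T_k(2) lies in the Krylov subspace, and its distance to c
    is at most |c|_A / T_k(2), and T_k(2) >= (2 + sqrt 3)^k / 2.  The PCG iterate,
    being optimal, is at least as close ([pcg_error_bound]).  Finally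
    2 + sqrt 3 >= exp (2 / sqrt 3) makes the stated number of iterations
    sufficient.

    All functions take finitely many values, so every expectation is a finite
    sum weighted by the joint law of the hash and sign functions. *)

(** * Cauchy-Schwarz for finite sums *)

Section CauchySchwarz.
Variables (R : realDomainType) (I : finType).
Implicit Types f g : I -> R.

(** Lagrange's identity: the difference of the two sides is half the sum of the
    squares of the 2 x 2 minors of (f, g). *)
Lemma sum_CauchySchwarz f g :
  (\sum_i f i * g i) ^+ 2 <= (\sum_i f i ^+ 2) * (\sum_i g i ^+ 2).
Proof.
have : 0 <= \sum_i \sum_j (f i * g j - f j * g i) ^+ 2.
  by do 2 (apply: sumr_ge0 => ? _); exact: sqr_ge0.
have -> : \sum_i \sum_j (f i * g j - f j * g i) ^+ 2 =
  \sum_i \sum_j (f i ^+ 2 * g j ^+ 2) + \sum_i \sum_j (f j ^+ 2 * g i ^+ 2)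
  - 2 * \sum_i \sum_j (f i * g i) * (f j * g j).
  rewrite mulr_sumr -sumrN -!big_split; apply: eq_bigr => i _ /=.
  rewrite mulr_sumr -sumrN -!big_split; apply: eq_bigr => j _ /=; ring.
rewrite [X in _ + X - _]exchange_big /= expr2 !big_distrlr /=.
lra.
Qed.

End CauchySchwarz.

(** * Energy forms and orthogonal projection *)

Section Forms.
Variables (R : realType) (n : nat).
Implicit Types (A C : 'M[R]_n) (u v c : 'cV[R]_n).

Definition form A u v : R := (u^T *m A *m v) 0 0.

Lemma formDr A u v w : form A u (v + w) = form A u v + form A u w.
Proof. by rewrite /form mulmxDr mxE. Qed.

Lemma formZr A a u v : form A u (a *: v) = a * form A u v.
Proof. by rewrite /form -scalemxAr mxE. Qed.

Lemma formNr A u v : form A u (- v) = - form A u v.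
Proof. by rewrite /form mulmxN mxE. Qed.

Lemma formDl A u v w : form A (u + v) w = form A u w + form A v w.
Proof. by rewrite /form linearD /= !mulmxDl mxE. Qed.

Lemma formZl A a u v : form A (a *: u) v = a * form A u v.
Proof. by rewrite /form linearZ /= -!scalemxAl mxE. Qed.

Lemma formNl A u v : form A (- u) v = - form A u v.
Proof. by rewrite /form linearN /= !mulNmx mxE. Qed.

Definition formE := (formDr, formDl, formNr, formNl, formZr, formZl).

Lemma formC A : A^T = A -> forall u v, form A u v = form A v u.
Proof.
move=> symA u v; rewrite /form -[u^T *m A *m v]trmxK mxE.
by rewrite !trmx_mul trmxK symA mulmxA.
Qed.

Lemma form_adjoint A C : A^T = A -> C^T *m A = A *m C ->
  forall u v, form A (C *m u) v = form A u (C *m v).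
Proof.
move=> symA CA u v; rewrite /form trmx_mul -(mulmxA u^T C^T) CA.
by rewrite !mulmxA.
Qed.

Definition posdef A := forall u, u != 0 -> 0 < form A u u.

Lemma form_ge0 A u : posdef A -> 0 <= form A u u.
Proof.
move=> posA; have [->|/posA/ltW//] := eqVneq u 0.
by rewrite /form mulmx0 mxE.
Qed.

Lemma posdef_unit A : posdef A -> A \in unitmx.
Proof.
move=> posA; rewrite -row_free_unit -kermx_eq0; apply/eqP/row_matrixP => i.
rewrite row0; apply/eqP/negPn/negP => ri0.
have : 0 < form A (row i (kermx A))^T (row i (kermx A))^T.
  by apply: posA; apply: contra ri0 => /eqP h; rewrite -[row _ _]trmxK h trmx0.
by rewrite /form trmxK -row_mul mulmx_ker row0 mul0mx mxE ltxx.
Qed.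

(** Gram-Schmidt: adding a generator [a] to [s] amounts to adding the component
    [e] of [a] orthogonal to the span of [s], and the projection is corrected
    along [e] only. *)
Lemma ex_form_projection A (s : seq 'cV[R]_n) c :
  A^T = A -> posdef A ->
  exists2 u, u \in << s >>%VS & forall z, z \in << s >>%VS -> form A z (u - c) = 0.
Proof.
move=> symA posA; elim: s c => [|a s IHs] c.
  exists 0; first exact: mem0v.
  by move=> z; rewrite span_nil memv0 => /eqP ->; rewrite /form trmx0 !mul0mx mxE.
have [u us uP] := IHs c; have [b bs bP] := IHs a.
move eE : (a - b) => e; pose t := form A e (c - u) / form A e e.
(* If e = 0 then t = 0, since x / 0 = 0, and the projection is unchanged. *)
have seP z : z \in << s >>%VS -> form A z e = 0.
  by move=> /bP h; apply: oppr_inj; rewrite -eE -formNr opprB h oppr0.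
have subs : (<< s >> <= <<a :: s>>)%VS by rewrite span_cons addvSr.
have as_a : a \in <<a :: s>>%VS by rewrite memv_span ?mem_head.
exists (u + t *: e).
  apply: memvD; first exact: (subvP subs).
  by rewrite -eE; apply/memvZ/memvB => //; exact: (subvP subs).
have eP : form A e (u + t *: e - c) = 0.
  have [e0|/posA egt0] := eqVneq e 0; first by rewrite e0 /form trmx0 !mul0mx mxE.
  rewrite /t !formE; field; exact: lt0r_neq0.
move=> z; rewrite span_cons => /memv_addP [_ /vlineP [k ->] [z' z's ->]].
have -> : k *: a + z' = k *: e + (k *: b + z').
  by rewrite addrA -scalerDr -eE subrK.
have z's' : k *: b + z' \in << s >>%VS by rewrite memvD ?memvZ.
rewrite formDl formZl eP mulr0 add0r addrAC formDr uP // formZr seP //.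
by rewrite mulr0 addr0.
Qed.

(** The PCG iterate exists: by Pythagoras the orthogonal projection of [c]
    minimizes the energy of the error. *)
Lemma ex_energy_minimizer A (s : seq 'cV[R]_n) c :
  A^T = A -> posdef A ->
  exists2 u, u \in << s >>%VS &
    forall z, z \in << s >>%VS -> energy_norm A (u - c) <= energy_norm A (z - c).
Proof.
move=> symA posA; have [u us uP] := ex_form_projection s c symA posA.
exists u => // z zs; rewrite /energy_norm ler_wsqrtr // -!/(form _ _ _).
have -> : z - c = (z - u) + (u - c) by rewrite addrA subrK.
rewrite [leRHS]formDl !(formDr _ _ (z - u)) (formC symA (u - c)).
have -> : form A (z - u) (u - c) = 0 by apply: uP; rewrite memvB.
by rewrite addr0 add0r lerDr form_ge0.
Qed.

End Forms.

(** * Chebyshev recurrence and Krylov subspaces *)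

Section Chebyshev.
Variables (R : realType) (n : nat).
Implicit Types (A B C : 'M[R]_n) (c : 'cV[R]_n).

(** The vectors T_k(C) c and U_(k-1)(C) c, for the Chebyshev polynomials of the
    first and second kind.  The recurrence is the addition formula of cosine and
    sine: T_(k+1) = x T_k - (1 - x^2) U_(k-1) and U_k = T_k + x U_(k-1). *)
Definition cheb_pair C c k : 'cV[R]_n * 'cV[R]_n :=
  iter k (fun p => (C *m p.1 - (p.2 - C *m (C *m p.2)), p.1 + C *m p.2)) (c, 0).

(** The values T_k(2) and U_(k-1)(2): the recurrence of [cheb_pair] at x = 2. *)
Definition pell_pair k : R * R :=
  iter k (fun p => (2 * p.1 + 3 * p.2, p.1 + 2 * p.2)) (1, 0).

(** The Pell identity T_k^2 + (1 - x^2) U_(k-1)^2 = 1 at a self-adjoint [C],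
    paired with [c].  It follows from the recurrence by expanding, without
    diagonalizing [C]. *)
Lemma cheb_pell_identity A C c k : A^T = A -> C^T *m A = A *m C ->
  let: (t, u) := cheb_pair C c k in
  form A t t + (form A u u - form A (C *m u) (C *m u)) = form A c c.
Proof.
move=> symA CA; rewrite /cheb_pair; elim: k => [|k] /=.
  by rewrite mulmx0 /form mulmx0 mxE subrr addr0.
case: (iter _ _ _) => t u /= <-.
have adj := form_adjoint symA CA.
rewrite !mulmxDr !formE (adj t u) (formC symA u (C *m t)) (adj t u).
rewrite (formC symA (C *m u) t) (formC symA (C *m (C *m u)) u).
rewrite -(adj u (C *m u)) (formC symA (C *m (C *m u)) (C *m t)).
by ring.
Qed.

(** |T_k| <= 1 on [-1, 1], for operators: when [C] is a contraction the second
    summand of the Pell identity is nonnegative. *)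
Lemma cheb_energy_le A C c k : A^T = A -> C^T *m A = A *m C ->
  (forall u, form A (C *m u) (C *m u) <= form A u u) ->
  form A (cheb_pair C c k).1 (cheb_pair C c k).1 <= form A c c.
Proof.
move=> symA CA Cle; have := cheb_pell_identity c k symA CA.
case: cheb_pair => t u /= <-.
by rewrite lerDl subr_ge0.
Qed.

(** Powers of the fundamental unit 2 + sqrt 3 of Pell's equation and of its
    conjugate. *)
Lemma pell_pairP k (r := Num.sqrt 3 : R) :
  (pell_pair k).1 + r * (pell_pair k).2 = (2 + r) ^+ k /\
  (pell_pair k).1 - r * (pell_pair k).2 = (2 - r) ^+ k.
Proof.
have r2 : r ^+ 2 = 3 by rewrite sqr_sqrtr.
rewrite /pell_pair; elim: k => [|k] /=; first by rewrite mulr0 addr0 subr0 !expr0.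
case: (iter _ _ _) => a b /= [IH1 IH2].
by rewrite !exprS -IH1 -IH2 -r2; split; ring.
Qed.

Lemma pell_pair_ge k :
  (2 + Num.sqrt 3) ^+ k / 2 <= (pell_pair k).1.
Proof.
have [h1 h2] := pell_pairP k.
have : 0 <= (2 - Num.sqrt 3 : R) ^+ k.
  apply: exprn_ge0; rewrite subr_ge0 -[leRHS]ger0_norm // -sqrtr_sqr.
  by apply: ler_wsqrtr; lra.
lra.
Qed.

Definition krylov_span B (b : 'cV[R]_n) k : {vspace 'cV[R]_n} :=
  <<[seq iter j (mulmx B) b | j <- iota 0 k]>>%VS.

Lemma krylov_spanS B b k : (krylov_span B b k <= krylov_span B b k.+1)%VS.
Proof.
by apply: sub_span => v; rewrite -[k.+1]addn1 iotaD map_cat mem_cat => ->.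
Qed.

Lemma krylov_span_mul B b k v : v \in krylov_span B b k ->
  B *m v \in krylov_span B b k.+1.
Proof.
move=> vk; have -> : B *m v = linfun (mulmx B) v by rewrite lfunE.
have := memv_img (linfun (mulmx B)) vk; rewrite limg_span; apply/subvP.
apply: sub_span => w /mapP [_ /mapP [j jk ->] ->]; rewrite lfunE -iterS.
by apply: (map_f (fun j => iter j (mulmx B) b)); move: jk; rewrite !mem_iota.
Qed.

(** T_k(C) - T_k(2) is a polynomial of degree k in B that vanishes at B = 0,
    because C = 2 there.  The same holds for U_(k-1) and U_k, and carrying the
    three together keeps every step within one multiplication by [C]. *)
Lemma cheb_krylov B c k (C := 2%:M - (3 / 2) *: B) :
  (cheb_pair C c k).1 - (pell_pair k).1 *: c \in krylov_span B (B *m c) k.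
Proof.
pose V := krylov_span B (B *m c).
have CM v a j : v - a *: c \in V j -> C *m v - (2 * a) *: c \in V j.+1.
  move=> vj; have -> : C *m v - (2 * a) *: c =
     2 *: (v - a *: c) - (3 / 2) *: (B *m (v - a *: c)) - (3 / 2 * a) *: (B *m c).
    rewrite /C mulmxBl mul_scalar_mx -scalemxAl mulmxBr -scalemxAr.
    by apply/colP => i; rewrite !mxE; set bv := (\sum_(j < n) _); field.
  apply: memvB; first apply: memvB.
  - by rewrite memvZ // (subvP (krylov_spanS _ _ _)).
  - by rewrite memvZ // krylov_span_mul.
  - by apply/memvZ/memv_span; exact: mem_head.
have lift v j : v \in V j -> v \in V j.+1 by move/(subvP (krylov_spanS _ _ _)).
suff: [/\ (cheb_pair C c k).1 - (pell_pair k).1 *: c \in V k,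
          (cheb_pair C c k).2 - (pell_pair k).2 *: c \in V k
        & (cheb_pair C c k.+1).2 - (pell_pair k.+1).2 *: c \in V k] by case.
elim: k => [|k].
  by rewrite /= mulmx0 addr0 scale1r mulr0 addr0 scale1r scale0r !subrr mem0v.
rewrite /cheb_pair /pell_pair !iterS /=.
case: (iter _ _ (c, _)) => t u; case: (iter _ _ (1, _)) => a b /= [tk uk wk].
set t' := C *m t - (u - C *m (C *m u)).
have tk1 : t' - (2 * a + 3 * b) *: c \in V k.+1.
  (* The recurrence of t in the form T_(k+1) = x U_k - U_(k-1), which raises the
     degree by one only. *)
  have -> : t' - (2 * a + 3 * b) *: c =
    (C *m (t + C *m u) - (2 * (a + 2 * b)) *: c) - (u - b *: c).
    rewrite /t' mulmxDr; move: (C *m t) (C *m (C *m u)) => v1 v2.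
    by apply/colP => i; rewrite !mxE; ring.
  by apply: memvB; [exact: CM|exact: lift].
split=> //; first exact: lift.
have -> : t' + C *m (t + C *m u) - (2 * a + 3 * b + 2 * (a + 2 * b)) *: c
  = (t' - (2 * a + 3 * b) *: c) + (C *m (t + C *m u) - (2 * (a + 2 * b)) *: c).
  by rewrite scalerDl opprD addrACA.
by apply: memvD => //; exact: CM.
Qed.

End Chebyshev.

(** * Convergence of PCG with a spectrally close preconditioner *)

Section Preconditioner.
Variable R : realType.

Definition frob2 m n (E : 'M[R]_(m, n)) : R := \sum_i \sum_j E i j ^+ 2.

Lemma dot_sumE n (u v : 'cV[R]_n) : (u^T *m v) 0 0 = \sum_i u i 0 * v i 0.
Proof. by rewrite !mxE; apply: eq_bigr => i _; rewrite mxE. Qed.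

Lemma gram_formE n m (F : 'M[R]_(n, m)) u v :
  form (F *m F^T) u v = ((F^T *m u)^T *m (F^T *m v)) 0 0.
Proof. by rewrite /form trmx_mul trmxK !mulmxA. Qed.

Lemma frob2_mul_le m n (E : 'M[R]_(m, n)) (v : 'cV[R]_n) :
  ((E *m v)^T *m (E *m v)) 0 0 <= frob2 E * (v^T *m v) 0 0.
Proof.
rewrite !dot_sumE /frob2 mulr_suml; apply: ler_sum => i _.
by rewrite -expr2 mxE (le_trans (sum_CauchySchwarz _ _)).
Qed.

(** A rectangular square root of V V^T + lambda I (see [ridge_factorE]). *)
Definition ridge_factor n m (V : 'M[R]_(n, m)) lambda : 'M[R]_(n, m + n) :=
  row_mx V (Num.sqrt lambda)%:M.

Lemma ridge_factorE n m (V : 'M[R]_(n, m)) lambda : 0 <= lambda ->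
  ridge_factor V lambda *m (ridge_factor V lambda)^T = V *m V^T + lambda%:M.
Proof.
move=> l0; rewrite /ridge_factor tr_row_mx mul_row_col tr_scalar_mx.
by rewrite -scalar_mxM -expr2 sqr_sqrtr.
Qed.

Lemma ridge_posdef n m (V : 'M[R]_(n, m)) lambda : 0 < lambda ->
  posdef (V *m V^T + lambda%:M).
Proof.
move=> l0 u u0; rewrite /form mulmxDr mulmxDl mxE -/(form _ _ _) gram_formE.
rewrite mul_mx_scalar -scalemxAl [X in _ + X]mxE !dot_sumE.
rewrite ltr_wpDl ?mulr_gt0 //; first by apply: sumr_ge0 => i _; exact: sqr_ge0.
rewrite lt_neqAle eq_sym sumr_ge0 ?andbT => [|i _]; last exact: sqr_ge0.
apply: contra u0; rewrite psumr_eq0 => [/allP h|i _]; last exact: sqr_ge0.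
apply/eqP/colP => i; rewrite mxE.
by have /implyP/(_ isT) := h i (mem_index_enum _); rewrite mulf_eq0 orbb => /eqP.
Qed.

Lemma ridge_sym n m (V : 'M[R]_(n, m)) lambda :
  (V *m V^T + lambda%:M)^T = V *m V^T + lambda%:M.
Proof. by rewrite linearD /= trmx_mul trmxK tr_scalar_mx. Qed.

(** For A = F F^T invertible, this matrix W satisfies W^T W = A^-1, hence serves
    as a rectangular substitute for A^(-1/2). *)
Definition whitening n m (F : 'M[R]_(n, m)) := F^T *m invmx (F *m F^T).

(** With v = M^-1 A u and w = A^-1 (M - A) v one has u = v + w and
    C u = v / 2 + 2 w, so the claim reduces to |w|_A <= |v|_A / 2; and
    |w|_A = |E F^T v| where E is the whitened perturbation. *)
Lemma whitened_contraction n m (F : 'M[R]_(n, m)) (M : 'M[R]_n)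
    (A := F *m F^T) (C := 2%:M - (3 / 2) *: (invmx M *m A)) :
  A \in unitmx -> M \in unitmx ->
  frob2 (whitening F *m (M - A) *m (whitening F)^T) <= 1 / 4 ->
  forall u, form A (C *m u) (C *m u) <= form A u u.
Proof.
move=> uA uM hE u; set E := _ *m _ *m _ in hE.
pose v := invmx M *m A *m u; pose w := invmx A *m (M - A) *m v.
have symA : A^T = A by rewrite /A trmx_mul trmxK.
have uE : u = v + w.
  have -> : w = u - v.
    rewrite /w mulmxBr mulVmx // mulmxBl mul1mx; congr (_ - _).
    by rewrite /v -(mulmxA (invmx M)) -(mulmxA (invmx A)) mulKVmx // mulKmx.
  by rewrite addrC subrK.
have CuE : C *m u = 2^-1 *: v + 2 *: w.
  rewrite /C mulmxBl mul_scalar_mx -scalemxAl -/v {1}uE.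
  by apply/colP => i; rewrite !mxE; field.
have wv : form A w w <= form A v v / 4.
  have wE : F^T *m w = E *m (F^T *m v).
    have h : (whitening F)^T *m F^T = 1%:M.
      by rewrite -trmx_mul /whitening mulmxA mulmxV // trmx1.
    by rewrite /E -(mulmxA _ (whitening F)^T) (mulmxA _ F^T) h mul1mx /w !mulmxA.
  rewrite !gram_formE wE (le_trans (frob2_mul_le _ _)) // mulrC.
  rewrite -[4^-1]div1r ler_wpM2l // dot_sumE.
  by apply: sumr_ge0 => i _; exact: sqr_ge0.
rewrite CuE uE; move: wv; rewrite !(formDr, formDl, formZr, formZl).
rewrite (formC symA w v); lra.
Qed.

(** The Krylov element c - T_k(C) c / T_k(2) has error T_k(C) c / T_k(2), and the
    iterate does at least as well. *)
Lemma pcg_error_bound n (A M : 'M[R]_n) (c : 'cV[R]_n) (T : int)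
    (C := 2%:M - (3 / 2) *: (invmx M *m A)) :
  A^T = A -> posdef A -> M^T = M ->
  (forall u, form A (C *m u) (C *m u) <= form A u u) ->
  exists2 c', is_pcg_iterate A M (A *m c) T c' &
    energy_norm A (c' - c) * (2 + Num.sqrt 3) ^+ `|Num.max T 0|%N
      <= 2 * energy_norm A c.
Proof.
move=> symA posA symM Cle; set k := `|_|%N.
pose B := invmx M *m A.
have krE : krylov A M (A *m c) T = krylov_span B (B *m c) k.
  by rewrite /krylov mulmxA.
have CA : C^T *m A = A *m C.
  rewrite /C linearB linearZ /= tr_scalar_mx trmx_mul symA trmx_inv symM.
  rewrite mulmxBl mulmxBr mul_scalar_mx mul_mx_scalar -scalemxAl -scalemxAr.
  by rewrite !mulmxA.
have [c' c'k c'min] := ex_energy_minimizer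
  [seq iter j (mulmx B) (B *m c) | j <- iota 0 k] c symA posA.
exists c'.
  split; first by rewrite krE.
  by move=> z; rewrite krE => zk; rewrite mulKmx ?posdef_unit // c'min.
pose t := (cheb_pair C c k).1; pose tau := (pell_pair R k).1.
have r_gt0 : 0 < (2 + Num.sqrt 3) ^+ k :> R.
  by apply: exprn_gt0; have := sqrtr_ge0 (3 : R); lra.
have tau_ge : (2 + Num.sqrt 3) ^+ k / 2 <= tau := pell_pair_ge R k.
have tau_gt0 : 0 < tau by lra.
pose z := - tau^-1 *: (t - tau *: c).
have zc : z - c = - tau^-1 *: t.
  apply/colP => i; rewrite !mxE; field; exact: lt0r_neq0.
have zk : z \in krylov_span B (B *m c) k by rewrite memvZ // cheb_krylov.
have : energy_norm A (z - c) <= tau^-1 * energy_norm A c.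
  rewrite zc /energy_norm -!/(form _ _ _) formZr formZl mulrA mulrNN -expr2.
  rewrite sqrtrM ?sqr_ge0 // sqrtr_sqr ger0_norm; last by rewrite invr_ge0 ltW.
  rewrite ler_pM2l ?invr_gt0 // ler_wsqrtr //.
  exact: cheb_energy_le.
move/(le_trans (c'min _ zk)); rewrite mulrC ler_pdivlMr // => h.
have e0 : 0 <= energy_norm A (c' - c) by exact: sqrtr_ge0.
have := ler_wpM2l e0 tau_ge; lra.
Qed.

(** This is 2 x <= ln ((1 + x) / (1 - x)) at x = 1 / sqrt 3.  It is obtained from
    exp y >= 1 + y at y = - 1 / (4 sqrt 3) = - sqrt 3 / 12, raised to the power 8,
    which is precise enough since 2 - sqrt 3 < 0.85^8. *)
Lemma expR_two_div_sqrt3_le : expR (2 / Num.sqrt 3) <= 2 + Num.sqrt 3 :> R.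
Proof.
set r := Num.sqrt 3.
have r2 : r ^+ 2 = 3 by rewrite sqr_sqrtr.
have r0 : 0 <= r by exact: sqrtr_ge0.
have r_gt0 : 0 < r by rewrite sqrtr_gt0.
have rlo : 45 / 26 <= r by nra.
have rhi : r <= 9 / 5 by nra.
have -> : 2 + r = (2 - r)^-1.
  have q0 : 2 - r != 0 by apply: lt0r_neq0; lra.
  by apply: (mulIf q0); rewrite mulVf // mulrC -subr_sqr r2; lra.
have -> : 2 / r = - (8%:R * (- (r / 12))).
  have : r * r = 3 by rewrite -expr2.
  move=> rr; apply: (mulIf (lt0r_neq0 r_gt0)).
  rewrite mulfVK ?lt0r_neq0 //; lra.
rewrite expRN lef_pV2 ?posrE ?expR_gt0 //; last by lra.
rewrite expRM_natl.
have h : 17 / 20 <= expR (- (r / 12)).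
  by apply: le_trans (expR_ge1Dx _); lra.
apply: (@le_trans _ _ ((17 / 20) ^+ 8)); first by lra.
by rewrite lerXn2r // nnegrE ?expR_ge0 //; lra.
Qed.

Lemma pcg_iterations_suffice (eps : R) : 0 < eps ->
  2 <= eps * (2 + Num.sqrt 3)
    ^+ `|Num.max (Num.ceil (Num.sqrt 3 / 2 * ln (2 / eps))) 0|%N.
Proof.
move=> e0; set T := Num.ceil _; set k := `|_|%N.
have r_gt0 : 0 < Num.sqrt 3 :> R by rewrite sqrtr_gt0.
have Tk : Num.sqrt 3 / 2 * ln (2 / eps) <= k%:R.
  apply: le_trans (ceil_ge _) _; rewrite -/T.
  have -> : (k%:R : R) = (Num.max T 0)%:~R.
    by rewrite -[LHS]/(k%:Z%:~R) /k gez0_abs // le_max lexx orbT.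
  by rewrite ler_int le_max lexx.
rewrite mulrC -ler_pdivrMr // -[leLHS]lnK ?posrE ?divr_gt0 //.
apply: (@le_trans _ _ (expR (k%:R * (2 / Num.sqrt 3)))).
  rewrite ler_expR mulrA ler_pdivlMr // -[leRHS]mulrC; lra.
by rewrite expRM_natl lerXn2r ?nnegrE ?expR_ge0 ?expR_two_div_sqrt3_le
  ?addr_ge0 ?ltW.
Qed.

End Preconditioner.

(** * Sums over paired quadruples of multi-indices *)

Section Pairings.
Variables (R : realType) (D : finType).

Definition norm2 (T : finType) (f : T -> R) : R := Num.sqrt (\sum_i f i ^+ 2).

(** The number of ways to split the positions 1, ..., 4 into two pairs carrying
    equal values; it dominates the expectation of a product of four signs. *)
Definition pairings (a b c e : D) : R :=
  ((a == b) && (c == e))%:R + ((a == c) && (b == e))%:R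
  + ((a == e) && (b == c))%:R.

Lemma pairings_ge0 a b c e : 0 <= pairings a b c e.
Proof. by rewrite /pairings !addr_ge0. Qed.

Lemma norm2_ge0 (T : finType) (f : T -> R) : 0 <= norm2 f.
Proof. exact: sqrtr_ge0. Qed.

Lemma sqr_norm2 (T : finType) (f : T -> R) : norm2 f ^+ 2 = \sum_i f i ^+ 2.
Proof. by rewrite sqr_sqrtr // sumr_ge0 // => i _; exact: sqr_ge0. Qed.

Lemma sum_mul_le_norm2 (T : finType) (f g : T -> R) :
  \sum_i f i * g i <= norm2 f * norm2 g.
Proof.
apply: le_trans (ler_norm _) _.
rewrite -ler_sqr ?nnegrE ?mulr_ge0 ?norm2_ge0 // real_normK ?num_real //.
by rewrite exprMn !sqr_norm2 sum_CauchySchwarz.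
Qed.

(** Each of the three pairings contributes a product of two inner products. *)
Lemma sum_pairings_le (f1 f2 f3 f4 : D -> R) :
  (forall a, 0 <= f1 a) -> (forall a, 0 <= f2 a) ->
  (forall a, 0 <= f3 a) -> (forall a, 0 <= f4 a) ->
  \sum_a \sum_b \sum_c \sum_e
    pairings a b c e * (f1 a * f2 b * f3 c * f4 e)
  <= 3 * (norm2 f1 * norm2 f2 * norm2 f3 * norm2 f4).
Proof.
move=> p1 p2 p3 p4.
have sum1 (a : D) (F : D -> R) : \sum_b (a == b)%:R * F b = F a.
  rewrite (bigD1 a) //= eqxx mul1r big1 ?addr0 // => b.
  by rewrite eq_sym => /negPf ->; rewrite mul0r.
pose dot f g : R := \sum_(a : D) f a * g a.
have dot_ge0 f g : (forall a, 0 <= f a) -> (forall a, 0 <= g a) -> 0 <= dot f g.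
  by move=> pf pg; apply: sumr_ge0 => a _; apply: mulr_ge0.
have dotM f g f' g' : (forall a, 0 <= f a) -> (forall a, 0 <= g a) ->
    (forall a, 0 <= f' a) -> (forall a, 0 <= g' a) ->
    dot f g * dot f' g' <= norm2 f * norm2 g * (norm2 f' * norm2 g').
  by move=> *; rewrite ler_pM ?dot_ge0 ?sum_mul_le_norm2.
suff -> : \sum_a \sum_b \sum_c \sum_e
    pairings a b c e * (f1 a * f2 b * f3 c * f4 e)
  = dot f1 f2 * dot f3 f4 + dot f1 f3 * dot f2 f4 + dot f1 f4 * dot f2 f3.
  have := dotM _ _ _ _ p1 p2 p3 p4; have := dotM _ _ _ _ p1 p3 p2 p4.
  have := dotM _ _ _ _ p1 p4 p2 p3; lra.
rewrite /dot !big_distrlr /= -!big_split; apply: eq_bigr => a _ /=.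
transitivity (\sum_b (\sum_c (a == b)%:R * (f1 a * f2 b * (f3 c * f4 c))
   + f1 a * f3 a * (f2 b * f4 b) + f1 a * f4 a * (f2 b * f3 b))).
  apply: eq_bigr => b _.
  rewrite -[f1 a * f3 a * _](sum1 a (fun c => f1 a * f3 c * (f2 b * f4 b))).
  rewrite -[f1 a * f4 a * _](sum1 b (fun c => f1 a * f4 a * (f2 b * f3 c))).
  rewrite -!big_split; apply: eq_bigr => c _ /=.
  rewrite -(sum1 c (fun e => (a == b)%:R * (f1 a * f2 b * (f3 c * f4 e)))).
  rewrite -(sum1 b (fun e => (a == c)%:R * (f1 a * f3 c * (f2 b * f4 e)))).
  rewrite -(sum1 a (fun e => (b == c)%:R * (f1 a * f4 e * (f2 b * f3 c)))).
  rewrite -!big_split; apply: eq_bigr => e _ /=.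
  by rewrite /pairings -!mulnb !natrM; ring.
rewrite !big_split /=; congr (_ + _ + _).
rewrite -(sum1 a (fun b => \sum_c f1 a * f2 b * (f3 c * f4 c))).
by apply: eq_bigr => b _; rewrite mulr_sumr.
Qed.

Definition fcons q (a : D) (v : {ffun 'I_q -> D}) : {ffun 'I_q.+1 -> D} :=
  [ffun k => oapp v a (unlift ord0 k)].

(** Fubini for the first coordinate of a multi-index. *)
Lemma sum_fcons q (F : {ffun 'I_q.+1 -> D} -> R) :
  \sum_v F v = \sum_a \sum_v F (fcons a v).
Proof.
rewrite pair_big /= (reindex (fun p => fcons p.1 p.2)) //=.
exists (fun v => (v ord0, [ffun k => v (lift ord0 k)])) => [[a v] _|v _] /=.
  rewrite ffunE unlift_none /=; congr (_, _).
  by apply/ffunP => k; rewrite !ffunE liftK.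
by apply/ffunP => k; rewrite ffunE; case: unliftP => [j|] kE; rewrite kE /= ?ffunE.
Qed.

Lemma norm2_fcons q (f : {ffun 'I_q.+1 -> D} -> R) :
  norm2 (fun a => norm2 (fun v => f (fcons a v))) = norm2 f.
Proof.
by rewrite /norm2 sum_fcons; under eq_bigr do rewrite sqr_norm2.
Qed.

(** Tensorization of [sum_pairings_le].  Fixing the first coordinates leaves a
    sum of the same shape for the slices of the four functions, which is why the
    functions are allowed to differ; the norms of the slices are then the
    functions to which the one-coordinate bound applies. *)
Lemma sum_prod_pairings_le q (f1 f2 f3 f4 : {ffun 'I_q -> D} -> R) :
  \sum_(i : {ffun 'I_q -> D}) \sum_(j : {ffun 'I_q -> D})
  \sum_(k : {ffun 'I_q -> D}) \sum_(l : {ffun 'I_q -> D})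
    (\prod_m pairings (i m) (j m) (k m) (l m)) * (f1 i * f2 j * f3 k * f4 l)
  <= 3 ^+ q * (norm2 f1 * norm2 f2 * norm2 f3 * norm2 f4).
Proof.
elim: q => [|q IHq] in f1 f2 f3 f4 *.
  have sum1 (F : {ffun 'I_0 -> D} -> R) : \sum_i F i = F (ffun0 (card_ord 0)).
    by apply: big_pred1 => i; apply/esym/eqP/ffunP => - [].
  rewrite /norm2 !sum1 big_ord0 expr0 !mul1r !sqrtr_sqr -!normrM; exact: ler_norm.
rewrite sum_fcons.
pose s1 a := norm2 (fun v => f1 (fcons a v)).
pose s2 a := norm2 (fun v => f2 (fcons a v)).
pose s3 a := norm2 (fun v => f3 (fcons a v)).
pose s4 a := norm2 (fun v => f4 (fcons a v)).
apply: (@le_trans _ _ (\sum_a \sum_b \sum_c \sum_e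
   pairings a b c e * (3 ^+ q * (s1 a * s2 b * s3 c * s4 e)))); last first.
  have : 3 ^+ q * (\sum_a \sum_b \sum_c \sum_e
      pairings a b c e * (s1 a * s2 b * s3 c * s4 e))
      <= 3 ^+ q * (3 * (norm2 s1 * norm2 s2 * norm2 s3 * norm2 s4)).
    apply: ler_wpM2l; first exact: exprn_ge0.
    by apply: sum_pairings_le => a; exact: norm2_ge0.
  rewrite !norm2_fcons mulrA -exprSr; apply: le_trans.
  rewrite le_eqVlt; apply/orP; left; apply/eqP.
  do 4 (rewrite mulr_sumr; apply: eq_bigr => ? _); ring.
apply: ler_sum => a _.
under eq_bigr => i _ do rewrite sum_fcons.
rewrite exchange_big; apply: ler_sum => b _ /=.
under eq_bigr => i _ do under eq_bigr => j _ do rewrite sum_fcons.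
under eq_bigr => i _ do rewrite exchange_big.
rewrite exchange_big; apply: ler_sum => c _ /=.
under eq_bigr => i _ do under eq_bigr => j _ do under eq_bigr => k _ do
  rewrite sum_fcons.
under eq_bigr => i _ do under eq_bigr => j _ do rewrite exchange_big.
under eq_bigr => i _ do rewrite exchange_big.
rewrite exchange_big; apply: ler_sum => e _ /=.
apply: le_trans (ler_wpM2l (pairings_ge0 a b c e) (IHq _ _ _ _)).
rewrite le_eqVlt; apply/orP; left; apply/eqP.
do 4 (rewrite mulr_sumr; apply: eq_bigr => ? _).
rewrite big_ord_recl -[LHS]mulrA /fcons !ffunE !unlift_none /=.
congr (_ * (_ * _)); apply: eq_bigr => m _.
by rewrite !ffunE !liftK.
Qed.

End Pairings.

(** * Expectations under finite product distributions *)

Section FiniteMeans.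
Variable R : realType.

Definition mean (T : finType) (p f : T -> R) : R := \sum_x p x * f x.

Definition is_weight (T : finType) (p : T -> R) :=
  (forall x, 0 <= p x) /\ \sum_x p x = 1.

Lemma mean_le (T : finType) (p f : T -> R) C :
  is_weight p -> (forall x, f x <= C) -> mean p f <= C.
Proof.
move=> [p0 p1] fC; rewrite -[leRHS]mul1r -p1 mulr_suml.
by apply: ler_sum => x _; apply: ler_wpM2l.
Qed.

Lemma ler_mean (T : finType) (p f g : T -> R) :
  is_weight p -> (forall x, f x <= g x) -> mean p f <= mean p g.
Proof. by move=> [p0 _] fg; apply: ler_sum => x _; apply: ler_wpM2l. Qed.

Lemma mean_ge0 (T : finType) (p f : T -> R) :
  is_weight p -> (forall x, 0 <= f x) -> 0 <= mean p f.
Proof. by move=> [p0 _] f0; apply: sumr_ge0 => x _; apply: mulr_ge0. Qed.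

(** Markov's inequality, stated for the complementary event. *)
Lemma finite_markov (T : finType) (p f : T -> R) a : is_weight p ->
  (forall x, 0 <= f x) -> 0 < a -> 1 - mean p f / a <= \sum_(x | f x <= a) p x.
Proof.
move=> [p0 p1] f0 a0; rewrite lerBlDr -p1 (bigID (fun x => f x <= a)) /=.
rewrite lerD2l ler_pdivlMr // mulr_suml /mean [leRHS](bigID (fun x => f x <= a)).
rewrite -[leLHS]add0r lerD //.
  by apply: sumr_ge0 => x _; apply: mulr_ge0.
by apply: ler_sum => x; rewrite -ltNge => /ltW; apply: ler_wpM2l.
Qed.

Section Product.
Variables (I T : finType) (p : I -> T -> R).
Hypothesis p_weight : forall i, is_weight (p i).

Definition prod_weight (v : {ffun I -> T}) : R := \prod_i p i (v i).

Lemma mean_prod (f : I -> T -> R) :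
  mean prod_weight (fun v => \prod_i f i (v i)) = \prod_i mean (p i) (f i).
Proof.
rewrite /mean bigA_distr_bigA /=; apply: eq_bigr => v _.
by rewrite /prod_weight -big_split.
Qed.

Lemma prod_weightP : is_weight prod_weight.
Proof.
split=> [v|]; first by apply: prodr_ge0 => i _; case: (p_weight i) => + _.
rewrite /prod_weight -(bigA_distr_bigA (fun i x => p i x)) big1 // => i _.
by case: (p_weight i).
Qed.

Definition upd (v : {ffun I -> T}) k x : {ffun I -> T} :=
  [ffun i => if i == k then x else v i].

Lemma updE v k x i : upd v k x i = if i == k then x else v i.
Proof. by rewrite ffunE. Qed.

(** Redrawing one coordinate independently leaves a product distribution
    unchanged: exchanging the old and the new value is an involution that
    preserves the weight of the pair (v, x). *)
Lemma mean_resample k (f : {ffun I -> T} -> R) :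
  mean prod_weight f
  = mean prod_weight (fun v => mean (p k) (fun x => f (upd v k x))).
Proof.
transitivity (\sum_u prod_weight u.1 * p k u.2 * f u.1).
  rewrite -(pair_bigA _ (fun v x => prod_weight v * p k x * f v)) /=.
  apply: eq_bigr => v _; rewrite -mulr_suml -mulr_sumr.
  by case: (p_weight k) => _ ->; rewrite mulr1.
rewrite (reindex (fun u => (upd u.1 k u.2, u.1 k))) /=; last first.
  exists (fun u => (upd u.1 k u.2, u.1 k)) => [] [v x] _ /=;
    rewrite updE eqxx; congr pair;
    by apply/ffunP => i; rewrite !updE; case: eqP => [->|].
rewrite -(pair_bigA _ (fun v x =>
  prod_weight (upd v k x) * p k (v k) * f (upd v k x))) /=.
apply: eq_bigr => v _; rewrite [RHS]mulr_sumr; apply: eq_bigr => x _.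
rewrite mulrA; congr (_ * _).
rewrite /prod_weight (bigD1 k) //= updE eqxx [in RHS](bigD1 k) //=.
under eq_bigr => i /negPf ik do rewrite updE ik.
ring.
Qed.

End Product.

Section Kwise.
Variables D T : finType.
Hypothesis T_gt0 : (0 < #|T|)%N.

(** The joint law of any at most [k] values of the random function is uniform. *)
Definition kwise_weight k (p : {ffun D -> T} -> R) :=
  forall (J : {set D}) y, (#|J| <= k)%N ->
    mean p (fun x => [forall i in J, x i == y i]%:R) = #|T|%:R ^- #|J|.

Lemma kwise_weightW k l p : (l <= k)%N -> kwise_weight k p -> kwise_weight l p.
Proof. by move=> lk kw J y Jl; apply: kw; exact: leq_trans lk. Qed.

Definition unif_weight : D -> T -> R := fun _ _ => #|T|%:R^-1.

Lemma unif_weightP i : is_weight (unif_weight i).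
Proof.
split=> [x|]; first by rewrite invr_ge0.
by rewrite sumr_const -[LHS]mulr_natr mulVf // pnatr_eq0 -lt0n.
Qed.

(** A function of at most [k] values has the same expectation as under complete
    uniformity, which is a product distribution, so that [mean_resample] becomes
    available at single points of [D]. *)
Lemma kwise_mean k p (J : {set D}) (f : {ffun D -> T} -> R) :
  kwise_weight k p -> (#|J| <= k)%N ->
  (forall x y : {ffun D -> T}, (forall i, i \in J -> x i = y i) -> f x = f y) ->
  mean p f = mean (prod_weight unif_weight) f.
Proof.
move=> kw Jk fJ; pose t : R := #|T|%:R.
have t0 : t != 0 by rewrite pnatr_eq0 -lt0n.
pose agree (x y : {ffun D -> T}) := [forall i in J, x i == y i].
have agree_f x y : (agree x y)%:R * f y = (agree x y)%:R * f x.
  case h : (agree x y); rewrite ?mul0r //; congr (_ * _); apply/esym/fJ => i iJ.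
  by apply/eqP; move/forall_inP: h; apply.
(* Weighted by t^#|J|, the uniform y that agree with x on J have total mass 1,
   and f y = f x for each of them. *)
transitivity (\sum_x \sum_y p x * (t ^+ #|J| * prod_weight unif_weight y
    * ((agree x y)%:R * f y))).
  apply: eq_bigr => x _; rewrite -mulr_sumr; congr (_ * _).
  under eq_bigr => y _ do rewrite agree_f mulrA.
  rewrite -mulr_suml.
  under eq_bigr => y _ do rewrite -mulrA.
  rewrite -mulr_sumr.
  suff -> : \sum_y prod_weight unif_weight y * (agree x y)%:R = t ^- #|J|.
    by rewrite mulfV ?mul1r // expf_neq0.
  transitivity (mean (prod_weight unif_weight)
     (fun y => \prod_i (if i \in J then (x i == y i)%:R else 1))).
    apply: eq_bigr => y _; congr (_ * _); case h : (agree x y).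
      rewrite big1 // => i _; case: ifP => // iJ.
      by move/forall_inP: h => /(_ i iJ) ->.
    move/negbT/forall_inPn: h => [i iJ ne].
    by rewrite (bigD1 i) //= iJ (negPf ne) mul0r.
  rewrite (mean_prod unif_weight (fun i z => if i \in J then (x i == z)%:R else 1)).
  rewrite -exprVn -[RHS]prodr_const [RHS]big_mkcond; apply: eq_bigr => i _ /=.
  rewrite /mean /unif_weight -mulr_sumr; case: ifP => _.
    rewrite (bigD1 (x i)) //= eqxx big1 ?addr0 ?mulr1 // => z.
    by rewrite eq_sym => /negPf ->.
  by rewrite sumr_const mulVf.
rewrite exchange_big; apply: eq_bigr => y _ /=.
transitivity (t ^+ #|J| * prod_weight unif_weight y * f y
  * mean p (fun x => (agree x y)%:R)).
  by rewrite mulr_sumr; apply: eq_bigr => x _; ring.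
rewrite kw // -/t; field; exact: expf_neq0.
Qed.

End Kwise.

Definition sign (b : bool) : R := (-1) ^+ b.

Lemma sign_sqr b : sign b * sign b = 1.
Proof. by rewrite /sign -expr2 sqrr_sign. Qed.

(** Redrawing the sign at [a] averages the product to zero. *)
Lemma mean_sign_isolated (D : finType) (p : {ffun D -> bool} -> R) (a b c e : D) :
  kwise_weight 4 p -> a != b -> a != c -> a != e ->
  mean p (fun x => sign (x a) * (sign (x b) * sign (x c) * sign (x e))) = 0.
Proof.
move=> kw ab ac ae.
have b0 : (0 < #|{: bool}|)%N by rewrite card_bool.
rewrite (kwise_mean b0 (J := [set a; b; c; e]) kw); last first.
- move=> x y xy; rewrite !(xy _ _) //; by rewrite !inE eqxx ?orbT.
- have add1 (A : {set D}) z m : (#|A| <= m)%N -> (#|A :|: [set z]%SET| <= m.+1)%N.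
    move=> Am; rewrite (leq_trans (leq_card_setU A [set z]%SET)) //.
    by rewrite cards1 addn1.
  by do 3 apply: (add1); rewrite cards1.
rewrite (mean_resample (fun i => unif_weightP b0 i) a) /mean.
apply: big1 => v _; rewrite -[X in _ * X]mulr_sumr big_bool !updE eqxx.
rewrite !(eq_sym _ a) (negPf ab) (negPf ac) (negPf ae).
rewrite /unif_weight [sign true]expr1 [sign false]expr0 /=.
by rewrite mulN1r mul1r addNr !mulr0.
Qed.

(** Four points either split into two equal pairs, and the product is then
    identically 1, or one of them differs from the three others. *)
Lemma mean_sign4_le (D : finType) (p : {ffun D -> bool} -> R) (a b c e : D) :
  is_weight p -> kwise_weight 4 p ->
  `|mean p (fun x => sign (x a) * sign (x b) * (sign (x c) * sign (x e)))|
    <= pairings R a b c e.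
Proof.
move=> pw kw.
have iso a' b' c' e' (f : {ffun D -> bool} -> R) :
    (forall x, f x = sign (x a') * (sign (x b') * sign (x c') * sign (x e'))) ->
    a' != b' -> a' != c' -> a' != e' -> `|mean p f| <= pairings R a b c e.
  move=> fE h1 h2 h3; rewrite [mean p f](_ : _ = 0) ?normr0 ?pairings_ge0 //.
  rewrite -[RHS](mean_sign_isolated kw h1 h2 h3).
  by apply: eq_bigr => x _; rewrite fE.
have paired (f : {ffun D -> bool} -> R) : (forall x, f x = 1) ->
    1 <= pairings R a b c e -> `|mean p f| <= pairings R a b c e.
  move=> f1; apply: le_trans; rewrite ger0_norm ?mean_le ?mean_ge0 // => x;
    by rewrite f1.
have [ab|ab] := eqVneq a b.
  have [ce|ce] := eqVneq c e.
    apply: paired; first by move=> x; rewrite ab ce !sign_sqr mulr1.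
    by rewrite /pairings ab ce !eqxx -addrA lerDl addr_ge0.
  have [cb|cb] := eqVneq c b.
    apply: (iso e a b c) => [x|||]; first by ring.
    - by rewrite ab -cb eq_sym.
    - by rewrite -cb eq_sym.
    - by rewrite eq_sym.
  by apply: (iso c a b e); rewrite ?ab // => x; ring.
have [ac|ac] := eqVneq a c.
  have [be|be] := eqVneq b e.
    apply: paired; first by move=> x; rewrite -ac -be mulrACA !sign_sqr mulr1.
    by rewrite /pairings -ac -be !eqxx addrAC lerDr addr_ge0.
  by apply: (iso b a c e); rewrite -?ac ?(eq_sym b a) // => x; ring.
have [ae|ae] := eqVneq a e.
  have [bc|bc] := eqVneq b c.
    apply: paired => [x|].
      by rewrite -ae -bc [X in _ * X]mulrC mulrACA !sign_sqr mulr1.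
    by rewrite /pairings -ae -bc !eqxx lerDr addr_ge0.
  by apply: (iso b a c e); rewrite -?ae ?(eq_sym b a) // => x; ring.
by apply: (iso a b c e) => // x; ring.
Qed.

End FiniteMeans.

(** * Second moment of the TensorSketch error *)

Section SketchMoment.
Variables (R : realType) (q d s : nat).
Hypothesis s_gt0 : (0 < s)%N.
Local Notation multi := {ffun 'I_q -> 'I_d}.
Variables (ph : 'I_q -> {ffun 'I_d -> 'I_s} -> R)
          (pg : 'I_q -> {ffun 'I_d -> bool} -> R).
Hypotheses (ph_weight : forall k, is_weight (ph k))
           (pg_weight : forall k, is_weight (pg k))
           (ph_indep : forall k, kwise_weight 2 (ph k))
           (pg_indep : forall k, kwise_weight 4 (pg k)).

Lemma sum_shift_mod_le1 (r c : nat) :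
  \sum_(t < s) ((t + r) %% s == c)%N%:R <= 1 :> R.
Proof.
case: (pickP (fun t : 'I_s => (t + r) %% s == c)%N) => [t0 /eqP t0c|none].
  rewrite (bigD1 t0) //= t0c eqxx big1 ?addr0 // => t tt0.
  rewrite (_ : (_ == c) = false) //; apply: contraNF tt0 => /eqP tc.
  move/eqP: (etrans tc (esym t0c)); rewrite eqn_modDr !modn_small //.
by rewrite big1 // => t _; rewrite none.
Qed.

(** At a coordinate [k0] where [i] and [j] differ, redraw first the hash function
    of that coordinate and then its value at [i k0]: all other hash values being
    fixed, at most one of the [s] values makes [i] and [j] collide. *)
Lemma mean_collision_le (i j : multi) : i != j ->
  mean (prod_weight ph) (fun h => (sketch_hash h i == sketch_hash h j)%:R)
    <= s%:R^-1.
Proof.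
move=> ij; have [k0 k0ij] : exists k, i k != j k.
  apply/existsP; rewrite -negb_forall; apply: contra ij => /forallP h.
  by apply/eqP/ffunP => k; exact/eqP.
have s0 : (0 < #|'I_s|)%N by rewrite card_ord.
rewrite (mean_resample ph_weight k0).
apply: mean_le => [|h]; first exact: prod_weightP.
pose rest (i : multi) := (\sum_(k < q | k != k0) h k (i k))%N.
have hashE (x : {ffun 'I_d -> 'I_s}) (i' : multi) :
    sketch_hash (upd h k0 x) i' = ((x (i' k0) + rest i') %% s)%N.
  rewrite /sketch_hash (bigD1 k0) //= updE eqxx.
  by under eq_bigr => k /negPf kk0 do rewrite updE kk0.
rewrite (kwise_mean s0 (J := [set i k0; j k0]) (ph_indep k0)); last first.
- by move=> x y xy; rewrite !hashE !xy ?inE ?eqxx ?orbT.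
- by rewrite (leq_trans (leq_card_setU _ _)) // !cards1.
rewrite (mean_resample (fun i => unif_weightP R s0 i) (i k0)).
apply: mean_le => [|x]; first exact/prod_weightP/unif_weightP.
rewrite /mean /unif_weight -mulr_sumr card_ord ler_piMr ?invr_ge0 //.
under eq_bigr => t _ do
  rewrite !hashE !updE eqxx eq_sym [j k0 == _]eq_sym (negPf k0ij) eq_sym.
exact: sum_shift_mod_le1.
Qed.

(** The signs of different coordinates are independent, so the expectation
    factors. *)
Lemma mean_sign_le (i j k l : multi) :
  `|mean (prod_weight pg) (fun g =>
      sketch_sign R g i * sketch_sign R g j
      * (sketch_sign R g k * sketch_sign R g l))|
  <= \prod_m pairings R (i m) (j m) (k m) (l m).
Proof.
rewrite [mean _ _](_ : _ = \prod_m mean (pg m) (fun x =>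
    sign R (x (i m)) * sign R (x (j m)) * (sign R (x (k m)) * sign R (x (l m))))).
  rewrite normr_prod; apply: ler_prod => m _.
  by rewrite normr_ge0 mean_sign4_le.
by rewrite -mean_prod; apply: eq_bigr => g _; rewrite -!big_split.
Qed.

Definition joint_weight (v : {ffun 'I_q -> {ffun 'I_d -> 'I_s}}
    * {ffun 'I_q -> {ffun 'I_d -> bool}}) : R :=
  prod_weight ph v.1 * prod_weight pg v.2.

Lemma joint_weightP : is_weight joint_weight.
Proof.
have [h0 h1] := prod_weightP ph_weight; have [g0 g1] := prod_weightP pg_weight.
split=> [v|]; first exact: mulr_ge0.
rewrite -(pair_bigA _ (fun h g => prod_weight ph h * prod_weight pg g)) /=.
by under eq_bigr do rewrite -mulr_sumr g1 mulr1.
Qed.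

Lemma mean_joint f1 f2 : mean joint_weight (fun v => f1 v.1 * f2 v.2)
  = mean (prod_weight ph) f1 * mean (prod_weight pg) f2.
Proof.
rewrite /mean big_distrlr /= pair_bigA; apply: eq_bigr => v _.
by rewrite /joint_weight mulrACA.
Qed.

(** The inner product of the sketches of [x] and [y], expanded over pairs of
    multi-indices. *)
Definition sketch_dot (h : 'I_q -> {ffun 'I_d -> 'I_s})
    (g : 'I_q -> {ffun 'I_d -> bool}) (x y : multi -> R) : R :=
  \sum_i \sum_j x i * y j * ((sketch_hash h i == sketch_hash h j)%:R
    * (sketch_sign R g i * sketch_sign R g j)).

(** The diagonal terms i = j are exact, since signs square to 1. *)
Lemma sketch_dot_err h g x y : sketch_dot h g x y - \sum_i x i * y i =
  \sum_(p : multi * multi | p.2 != p.1) x p.1 * y p.2 *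
    ((sketch_hash h p.1 == sketch_hash h p.2)%:R
     * (sketch_sign R g p.1 * sketch_sign R g p.2)).
Proof.
rewrite /sketch_dot -sumrB -(pair_big_dep xpredT (fun i j => j != i)
  (fun i j => x i * y j * ((sketch_hash h i == sketch_hash h j)%:R
    * (sketch_sign R g i * sketch_sign R g j)))) /=.
apply: eq_bigr => i _; rewrite (bigD1 i) //= eqxx mul1r.
have -> : sketch_sign R g i * sketch_sign R g i = 1.
  by rewrite /sketch_sign -big_split big1 // => k _ /=; rewrite -expr2 sqrr_sign.
by rewrite mulr1 addrAC subrr add0r.
Qed.

(** Expand the square over pairs of off-diagonal multi-index pairs.  The hash
    factor of each term is at most the probability 1/s of the first collision
    alone, and the sign factor is at most a product of pairing counts; the sum
    that remains is bounded by [sum_prod_pairings_le]. *)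
Lemma sketch_dot_moment (x y : multi -> R) :
  mean joint_weight (fun v => (sketch_dot v.1 v.2 x y - \sum_i x i * y i) ^+ 2)
  <= 3 ^+ q / s%:R * ((\sum_i x i ^+ 2) * (\sum_i y i ^+ 2)).
Proof.
pose P (p : multi * multi) := p.2 != p.1.
pose a (p : multi * multi) := x p.1 * y p.2.
pose C (h : {ffun 'I_q -> {ffun 'I_d -> 'I_s}}) (p : multi * multi) : R :=
  (sketch_hash h p.1 == sketch_hash h p.2)%:R.
pose S (g : {ffun 'I_q -> {ffun 'I_d -> bool}}) (p : multi * multi) :=
  sketch_sign R g p.1 * sketch_sign R g p.2.
pose pr (p p' : multi * multi) :=
  \prod_m pairings R (p.1 m) (p.2 m) (p'.1 m) (p'.2 m).
have pr0 p p' : 0 <= pr p p' by apply: prodr_ge0 => m _; exact: pairings_ge0.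
have C0 h p : 0 <= C h p by rewrite /C.
have C1 h p : C h p <= 1 by rewrite /C lern1 leq_b1.
have phw := prod_weightP ph_weight.
have -> : mean joint_weight
    (fun v => (sketch_dot v.1 v.2 x y - \sum_i x i * y i) ^+ 2)
  = \sum_(p | P p) \sum_(p' | P p') a p * a p'
     * (mean (prod_weight ph) (fun h => C h p * C h p')
        * mean (prod_weight pg) (fun g => S g p * S g p')).
  transitivity (\sum_v \sum_(p | P p) \sum_(p' | P p')
      joint_weight v * (a p * a p' * (C v.1 p * C v.1 p' * (S v.2 p * S v.2 p')))).
    apply: eq_bigr => v _; rewrite sketch_dot_err expr2 big_distrlr mulr_sumr.
    apply: eq_bigr => p _; rewrite mulr_sumr; apply: eq_bigr => p' _ /=.
    rewrite /a /C /S; ring.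
  rewrite exchange_big; apply: eq_bigr => p _ /=.
  rewrite exchange_big; apply: eq_bigr => p' _ /=.
  rewrite -(mean_joint (fun h => C h p * C h p') (fun g => S g p * S g p')).
  by rewrite mulr_sumr; apply: eq_bigr => v _; rewrite mulrCA.
pose b (p p' : multi * multi) := s%:R^-1 *
  (pr p p' * (`|x p.1| * `|y p.2| * `|x p'.1| * `|y p'.2|)).
have b0 p p' : 0 <= b p p' by rewrite !mulr_ge0 ?invr_ge0.
apply: (@le_trans _ _ (\sum_p \sum_p' b p p')).
  rewrite big_mkcond; apply: ler_sum => p _; case: ifP => Pp; last exact: sumr_ge0.
  rewrite big_mkcond; apply: ler_sum => p' _; case: ifP => // Pp'.
  apply: le_trans (ler_norm _) _; rewrite !normrM /b.
  rewrite [leRHS](_ : _ = `|x p.1| * `|y p.2| * (`|x p'.1| * `|y p'.2|) *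
     (s%:R^-1 * pr p p')); last by ring.
  apply: ler_wpM2l; first by rewrite !mulr_ge0.
  apply: ler_pM => //; last exact: mean_sign_le.
  rewrite ger0_norm; last by apply: mean_ge0 => // h; rewrite mulr_ge0.
  apply: le_trans (mean_collision_le (i := p.1) (j := p.2) _); last by rewrite eq_sym.
  by apply: ler_mean => // h; rewrite ler_piMr.
have -> : \sum_p \sum_p' b p p' = s%:R^-1 *
  \sum_(i : multi) \sum_(j : multi) \sum_(k : multi) \sum_(l : multi)
    (\prod_m pairings R (i m) (j m) (k m) (l m))
      * (`|x i| * `|y j| * `|x k| * `|y l|).
  rewrite [X in _ = _ * X]pair_bigA mulr_sumr; apply: eq_bigr => p _ /=.
  by rewrite pair_bigA mulr_sumr; apply: eq_bigr => p' _.
rewrite [3 ^+ q / _]mulrC -mulrA ler_wpM2l ?invr_ge0 //.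
apply: le_trans (sum_prod_pairings_le _ _ _ _) _.
apply: ler_wpM2l; first exact: exprn_ge0.
rewrite -mulrA mulrACA -!expr2 !sqr_norm2.
by rewrite le_eqVlt; apply/orP; left; apply/eqP; congr (_ * _);
  apply: eq_bigr => i _; rewrite real_normK ?num_real.
Qed.

End SketchMoment.

(** * Laws of the random hash and sign functions *)

Section Laws.
Context (R : realType) (dis : measure_display) (Omega : measurableType dis).
Variable P : probability Omega R.

Definition law (T : finType) (X : Omega -> T) (x : T) : R :=
  fine (P (X @^-1` [set x])).

Lemma lawE (T : finType) (X : Omega -> T) x : finite_rv X ->
  (law X x)%:E = P (X @^-1` [set x]).
Proof. by move=> Xm; rewrite fineK // fin_num_measure. Qed.

(** Any event determined by a random variable with finitely many values is
    measurable, and its probability is a finite sum. *)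
Lemma probability_law (T : finType) (X : Omega -> T) (A : pred T) :
  finite_rv X -> P [set w | A (X w)] = (\sum_(x | A x) law X x)%:E.
Proof.
move=> Xm.
have -> : [set w | A (X w)] = \bigcup_(x in [set` enum A]) X @^-1` [set x].
  apply/seteqP; split=> [w /= Aw|w [x /= + ->]]; last by rewrite mem_enum.
  by exists (X w) => //=; rewrite mem_enum.
rewrite measure_fin_bigcup //; last first.
  by move=> x y _ _ [w [/= <- <-]].
rewrite -fsbig_seq ?enum_uniq // big_enum -sumEFin.
by apply: eq_bigr => x _; rewrite lawE.
Qed.

Lemma law_weight (T : finType) (X : Omega -> T) :
  finite_rv X -> is_weight (law X).
Proof.
move=> Xm; split=> [x|]; first by rewrite -lee_fin lawE.
have := probability_law predT Xm.
rewrite (_ : [set w | _] = setT); last by apply/seteqP; split.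
by rewrite probability_setT => -[].
Qed.

Lemma kwise_law k (D T : finType) (h : Omega -> {ffun D -> T}) :
  kwise_uniform P k h -> kwise_weight k (law h).
Proof.
move=> [hm unif indep] J y Jk; apply: EFin_inj.
transitivity (P [set w | [forall i in J, h w i == y i]]).
  rewrite (probability_law (fun x : {ffun D -> T} => [forall i in J, x i == y i])) //.
  congr EFin; rewrite /mean [RHS]big_mkcond; apply: eq_bigr => x _.
  by case: ifP => _; rewrite ?mulr1 ?mulr0.
have -> : [set w | [forall i in J, h w i == y i]]
    = \bigcap_(i in [set` J]) (fun w => h w i) @^-1` [set y i].
  apply/seteqP; split=> [w /forall_inP hw i iJ|w hw]; first exact/eqP/hw.
  by apply/forall_inP => i iJ; apply/eqP/hw.
rewrite indep // => [|i _]; last by exists [set y i].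
rewrite (eq_bigr (fun=> (#|T|%:R^-1)%:E)) => [|i _]; last exact: unif.
by rewrite prodEFin prodr_const exprVn.
Qed.

Section Joint.
Variables (q d s : nat) (h : 'I_q -> Omega -> {ffun 'I_d -> 'I_s})
  (g : 'I_q -> Omega -> {ffun 'I_d -> bool}).
Hypothesis hg : tensorsketch_functions P h g.

(** All the randomness of the sketch, as a single finite-valued variable. *)
Definition sketch_seed w := ([ffun k => h k w], [ffun k => g k w]).

Let seed_event v (c : 'I_q + 'I_q) :=
  match c with
  | inl k => h k @^-1` [set (v.1 : {ffun 'I_q -> {ffun 'I_d -> 'I_s}}) k]
  | inr k => g k @^-1` [set (v.2 : {ffun 'I_q -> {ffun 'I_d -> bool}}) k]
  end.

Lemma seed_preimage v : sketch_seed @^-1` [set v]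
  = \bigcap_(c in [set` [set: 'I_q + 'I_q]%SET]) seed_event v c.
Proof.
apply/seteqP; split=> [w <- [k|k] _|w hw] /=; rewrite ?ffunE //.
case: v hw => v1 v2 hw; congr pair; apply/ffunP => k; rewrite ffunE.
  by apply: (hw (inl k)); rewrite /= inE.
by apply: (hw (inr k)); rewrite /= inE.
Qed.

Lemma sketch_seed_rv : finite_rv sketch_seed.
Proof.
case: hg => hh gg _ v; rewrite seed_preimage.
apply: fin_bigcap_measurable; first exact: finite_finset.
by move=> [k|k] _ /=; [case: (hh k)|case: (gg k)].
Qed.

Lemma law_sketch_seed v :
  law sketch_seed v = joint_weight (fun k => law (h k)) (fun k => law (g k)) v.
Proof.
case: (hg) => hh gg indep; apply: EFin_inj.
rewrite lawE; last exact: sketch_seed_rv.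
rewrite seed_preimage indep ?cardsT // => [|[k|k] _]; last 2 first.
- by exists [set v.1 k].
- by exists [set v.2 k].
rewrite /joint_weight /prod_weight EFinM -!prodEFin.
under eq_bigl do rewrite inE.
rewrite big_sumType /=; congr (_ * _)%E; apply: eq_bigr => k _ /=.
  by rewrite lawE //; case: (hh k).
by rewrite lawE //; case: (gg k).
Qed.

End Joint.
End Laws.

(** * The kernel matrix as a Gram matrix *)

Section SketchedKernel.
Variables (R : realType) (n d q s : nat) (x : 'I_n -> 'cV[R]_d).
Local Notation multi := (multi_index q d).

Definition feature_mx : 'M[R]_(n, #|{: multi}|) :=
  \matrix_(i, c) tensor_power q (x i) c 0.

(** The q-th power of an inner product expands, by distributivity, into a sum
    over multi-indices. *)
Lemma kernel_gram :
  kernel_mx (@poly_kernel R q d) x = feature_mx *m feature_mx^T.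
Proof.
apply/matrixP => i j; rewrite !mxE /poly_kernel dot_sumE.
transitivity (\sum_(f : multi) \prod_k (x i (f k) 0 * x j (f k) 0)).
  by rewrite -(bigA_distr_bigA (fun _ m => x i m 0 * x j m 0)) prodr_const card_ord.
rewrite (reindex (fun c : 'I_#|{: multi}| => enum_val c)) /=; last first.
  by apply: onW_bij; exact: enum_val_bij.
by apply: eq_bigr => c _; rewrite !mxE -big_split.
Qed.

(** A bucket [r] contributes exactly the pairs (i, j) hashed into it, so summing
    over the buckets leaves the collision indicator. *)
Lemma gram_sketchE m (X : 'M[R]_(m, #|{: multi}|))
    (h : 'I_q -> {ffun 'I_d -> 'I_s}) (g : 'I_q -> {ffun 'I_d -> bool}) a b :
  (0 < s)%N ->
  (X *m (tensorsketch_mx R h g)^T *m tensorsketch_mx R h g *m X^T) a b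
  = sketch_dot h g (fun i => X a (enum_rank i)) (fun i => X b (enum_rank i)).
Proof.
move=> s0; set S := tensorsketch_mx R h g.
have SX r c : (S *m X^T) r c = \sum_(i : multi)
    X c (enum_rank i) * (sketch_sign R g i * (sketch_hash h i == r :> nat)%:R).
  rewrite mxE (reindex (fun i : multi => enum_rank i)) /=; last first.
    by apply: onW_bij; exact: enum_rank_bij.
  by apply: eq_bigr => i _; rewrite !mxE enum_rankK mulrC.
have -> : X *m S^T *m S *m X^T = (S *m X^T)^T *m (S *m X^T).
  by rewrite trmx_mul trmxK !mulmxA.
rewrite mxE /sketch_dot.
transitivity (\sum_(r < s) \sum_(i : multi) \sum_(j : multi)
   X a (enum_rank i) * X b (enum_rank j)
     * (sketch_sign R g i * sketch_sign R g j)
     * ((sketch_hash h i == r :> nat) && (sketch_hash h j == r :> nat))%:R).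
  apply: eq_bigr => r _; rewrite mxE !SX big_distrlr /=.
  apply: eq_bigr => i _; apply: eq_bigr => j _; rewrite -mulnb natrM; ring.
rewrite exchange_big; apply: eq_bigr => i _ /=.
rewrite exchange_big; apply: eq_bigr => j _ /=.
rewrite -mulr_sumr -!mulrA [_%:R * _]mulrC -!mulrA; do 4 congr (_ * _).
have hi : (sketch_hash h i < s)%N by rewrite ltn_pmod.
rewrite (bigD1 (Ordinal hi)) //= eqxx eq_sym big1 ?addr0 // => r.
by rewrite -val_eqE /= eq_sym => /negPf ->.
Qed.

(** This is where the statistical dimension enters:
    |W Phi|_F^2 = tr (W^T W Phi Phi^T) = tr (A^-1 K). *)
Lemma whitened_frob2 (lambda : R) : 0 < lambda ->
  let K := kernel_mx (@poly_kernel R q d) x in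
  let W := whitening (ridge_factor feature_mx lambda) in
  frob2 (W *m feature_mx) = statistical_dim lambda K.
Proof.
move=> l0 K W.
have KE : K = feature_mx *m feature_mx^T := kernel_gram.
have FF := ridge_factorE feature_mx (ltW l0).
have uA : K + lambda%:M \in unitmx by rewrite KE posdef_unit //; exact: ridge_posdef.
have WW : W^T *m W = invmx (K + lambda%:M).
  rewrite /W /whitening FF -KE trmx_mul trmxK trmx_inv.
  rewrite [(K + _)^T](_ : _ = K + lambda%:M); last by rewrite KE ridge_sym.
  by rewrite mulmxA -(mulmxA (invmx _) (ridge_factor _ _)) FF -KE mulVmx // mul1mx.
have -> : frob2 (W *m feature_mx) = \tr ((W *m feature_mx) *m (W *m feature_mx)^T).
  apply: eq_bigr => i _; rewrite mxE; apply: eq_bigr => j _.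
  by rewrite [X in _ = _ * X]mxE expr2.
rewrite trmx_mul -mulmxA (mulmxA feature_mx) -KE mxtrace_mulC -mulmxA.
by rewrite WW mxtrace_mulC.
Qed.

End SketchedKernel.

(** * PCG with the sketched preconditioner *)

Section SketchedPCG.
Variables (R : realType) (n d q s : nat) (x : 'I_n -> 'cV[R]_d) (lambda : R).
Hypotheses (s_gt0 : (0 < s)%N) (lambda_gt0 : 0 < lambda).
Local Notation multi := (multi_index q d).
Local Notation K := (kernel_mx (@poly_kernel R q d) x).
Local Notation A := (K + lambda%:M).
Local Notation F := (ridge_factor (feature_mx q x) lambda).

Definition sketched_mx (h : 'I_q -> {ffun 'I_d -> 'I_s})
    (g : 'I_q -> {ffun 'I_d -> bool}) : 'M[R]_(n, s) :=
  \matrix_(i < n) (tensorsketch h g (x i))^T.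

Definition white_feature (a : 'I_(#|{: multi}| + n)) (i : multi) : R :=
  (whitening F *m feature_mx q x) a (enum_rank i).

(** The squared Frobenius norm of the whitened error of the sketched Gram matrix
    (see [sketch_lossE]), as a function of the hash and sign functions. *)
Definition sketch_loss (h : 'I_q -> {ffun 'I_d -> 'I_s})
    (g : 'I_q -> {ffun 'I_d -> bool}) : R :=
  \sum_a \sum_b (sketch_dot h g (white_feature a) (white_feature b)
    - \sum_i white_feature a i * white_feature b i) ^+ 2.

Lemma sum_white_feature :
  \sum_a \sum_i white_feature a i ^+ 2 = statistical_dim lambda K.
Proof.
rewrite -whitened_frob2 //; apply: eq_bigr => a _.
rewrite [RHS](reindex (fun i : multi => enum_rank i)) //=.
by apply: onW_bij; exact: enum_rank_bij.
Qed.

Lemma sketched_mxE h g :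
  sketched_mx h g = feature_mx q x *m (tensorsketch_mx R h g)^T.
Proof.
apply/matrixP => i r; rewrite !mxE; apply: eq_bigr => c _.
by rewrite mulrC; congr (_ * _); rewrite !mxE.
Qed.

Lemma sketch_lossE h g (M := sketched_mx h g *m (sketched_mx h g)^T + lambda%:M) :
  frob2 (whitening F *m (M - A) *m (whitening F)^T) = sketch_loss h g.
Proof.
rewrite /M opprD addrACA subrr addr0 kernel_gram sketched_mxE.
rewrite mulmxBr mulmxBl trmx_mul trmxK.
apply: eq_bigr => a _; apply: eq_bigr => b _; congr (_ ^+ 2).
rewrite mxE [X in _ + X]mxE; congr (_ - _).
  by rewrite -gram_sketchE // (trmx_mul (whitening F)) !mulmxA.
have -> : whitening F *m (feature_mx q x *m (feature_mx q x)^T) *m (whitening F)^T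
  = (whitening F *m feature_mx q x) *m (whitening F *m feature_mx q x)^T.
  by rewrite (trmx_mul (whitening F)) !mulmxA.
rewrite mxE (reindex (fun i : multi => enum_rank i)) /=; last first.
  by apply: onW_bij; exact: enum_rank_bij.
by apply: eq_bigr => i _; rewrite [X in _ * X]mxE.
Qed.

(** The deterministic half of the argument: 1/4 is the square of the relative
    perturbation 1/2 that [whitened_contraction] tolerates. *)
Lemma sketched_pcg_accurate h g (eps : R) c : 0 < eps -> sketch_loss h g <= 1 / 4 ->
  exists2 c', is_pcg_iterate A
      (sketched_mx h g *m (sketched_mx h g)^T + lambda%:M) (A *m c)
      (Num.ceil (Num.sqrt 3 / 2 * ln (2 / eps))) c'
    & energy_norm A (c' - c) <= eps * energy_norm A c.
Proof.
move=> e0 loss; set M := sketched_mx _ _ *m _ + _.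
have AE : A = F *m F^T by rewrite ridge_factorE ?ltW // kernel_gram.
have posA : posdef A by rewrite kernel_gram; exact: ridge_posdef.
have symA : A^T = A by rewrite kernel_gram ridge_sym.
have posM : posdef M := ridge_posdef _ lambda_gt0.
have Cle u : let C := 2%:M - (3 / 2) *: (invmx M *m A) in
    form A (C *m u) (C *m u) <= form A u u.
  rewrite /= AE; apply: whitened_contraction; rewrite -?AE ?posdef_unit //.
  by rewrite sketch_lossE.
have [c' c'P c'le] := pcg_error_bound c
  (Num.ceil (Num.sqrt 3 / 2 * ln (2 / eps))) symA posA (ridge_sym _ _) Cle.
exists c' => //.
set k := `|_|%N in c'le.
have r_gt0 : 0 < (2 + Num.sqrt 3) ^+ k :> R.
  by rewrite exprn_gt0 // ltr_pwDl // sqrtr_ge0.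
rewrite -(ler_pM2r r_gt0) (le_trans c'le) // mulrAC.
by rewrite ler_wpM2r ?sqrtr_ge0 ?pcg_iterations_suffice.
Qed.

(** Summing the second moments over all pairs of rows of the whitened feature
    matrix gives the square of its Frobenius norm. *)
Lemma mean_sketch_loss_le (ph : 'I_q -> {ffun 'I_d -> 'I_s} -> R)
    (pg : 'I_q -> {ffun 'I_d -> bool} -> R) :
  (forall k, is_weight (ph k)) -> (forall k, is_weight (pg k)) ->
  (forall k, kwise_weight 2 (ph k)) -> (forall k, kwise_weight 4 (pg k)) ->
  mean (joint_weight ph pg) (fun v => sketch_loss v.1 v.2)
  <= 3 ^+ q / s%:R * statistical_dim lambda K ^+ 2.
Proof.
move=> phw pgw ph2 pg4.
rewrite -sum_white_feature expr2 big_distrlr mulr_sumr /mean.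
under eq_bigr => v _ do rewrite mulr_sumr.
rewrite exchange_big; apply: ler_sum => a _ /=; rewrite mulr_sumr.
under eq_bigr => v _ do rewrite mulr_sumr.
rewrite exchange_big; apply: ler_sum => b _ /=.
exact: sketch_dot_moment.
Qed.

End SketchedPCG.

Theorem theorem1 (R : realType) (dis : measure_display)
    (Omega : measurableType dis) (P : probability Omega R)
    (n d q s : nat) (hn : (1 <= n)%N) (hd : (1 <= d)%N) (hq : (1 <= q)%N)
    (hs : (1 <= s)%N)
    (x : 'I_n -> 'cV[R]_d) (y : 'cV[R]_n) (lambda eps delta : R)
    (hlambda : 0 < lambda) (heps : 0 < eps) (hdelta : 0 < delta < 1)
    (h : 'I_q -> Omega -> {ffun 'I_d -> 'I_s})
    (g : 'I_q -> Omega -> {ffun 'I_d -> bool})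
    (hhg : tensorsketch_functions P h g) (c : 'cV[R]_n) :
  let K := kernel_mx (@poly_kernel R q d) x in
  let A := K + lambda%:M in
  let Z (w : Omega) : 'M[R]_(n, s) :=
    \matrix_(i < n) (tensorsketch (fun k => h k w) (fun k => g k w) (x i))^T in
  let T : int := Num.ceil (Num.sqrt 3 / 2 * ln (2 / eps)) in
  A *m c = y ->
  4 * (2 + 3 ^+ q) * statistical_dim lambda K ^+ 2 / delta <= s%:R ->
  ((1 - delta)%:E <=
    P [set w | exists2 c' : 'cV[R]_n,
        is_pcg_iterate A (Z w *m (Z w)^T + lambda%:M) y T c' &
        (energy_norm A (c' - c) <= eps * energy_norm A c)%R])%E.
Proof.
move=> K A Z T Ac_y s_ge.
have [hh gg _] := hhg.
have hm k : finite_rv (h k) by case: (hh k).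
have gm k : finite_rv (g k) by case: (gg k).
pose good (v : {ffun 'I_q -> {ffun 'I_d -> 'I_s}}
             * {ffun 'I_q -> {ffun 'I_d -> bool}}) : bool :=
  `[< exists2 c' : 'cV[R]_n,
    is_pcg_iterate A (sketched_mx x v.1 v.2 *m (sketched_mx x v.1 v.2)^T
      + lambda%:M) y T c'
    & energy_norm A (c' - c) <= eps * energy_norm A c >].
have seedE w : sketched_mx x (sketch_seed h g w).1 (sketch_seed h g w).2 = Z w.
  have hE : (sketch_seed h g w).1 = (fun k => h k w) :> ('I_q -> _).
    by apply/funext => k; rewrite ffunE.
  have gE : (sketch_seed h g w).2 = (fun k => g k w) :> ('I_q -> _).
    by apply/funext => k; rewrite ffunE.
  by rewrite /sketched_mx hE gE.
(* The success event depends on w only through the seed, hence it is an event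
   about a finite-valued variable. *)
have -> : [set w | exists2 c' : 'cV[R]_n,
    is_pcg_iterate A (Z w *m (Z w)^T + lambda%:M) y T c' &
    energy_norm A (c' - c) <= eps * energy_norm A c]
  = [set w | good (sketch_seed h g w)].
  by apply/seteqP; split=> w /=; rewrite /good seedE => /asboolP.
rewrite (probability_law P good (sketch_seed_rv hhg)) lee_fin.
under eq_bigr do rewrite law_sketch_seed //.
set p := joint_weight _ _.
have pw : is_weight p.
  by apply: joint_weightP => k; exact: law_weight.
pose loss (v : {ffun 'I_q -> {ffun 'I_d -> 'I_s}}
             * {ffun 'I_q -> {ffun 'I_d -> bool}}) :=
  sketch_loss x lambda v.1 v.2.
have loss_mean : mean p loss <= 3 ^+ q / s%:R * statistical_dim lambda K ^+ 2.
  apply: mean_sketch_loss_le => // k; try exact: law_weight.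
    by apply: (@kwise_weightW _ _ _ 3) => //; exact: kwise_law.
  exact: kwise_law.
have loss_ge0 v : 0 <= loss v.
  by do 2 (apply: sumr_ge0 => ? _); exact: sqr_ge0.
have q0 : 0 < 1 / 4 :> R by [].
(* The loss exceeds 1/4 with probability at most
   4 * 3^q / s * s_lambda^2 <= delta. *)
apply: le_trans (le_trans (finite_markov pw loss_ge0 q0) _).
  have [d0 _] := andP hdelta.
  have sR : 0 < s%:R :> R by rewrite ltr0n.
  have : 3 ^+ q / s%:R * statistical_dim lambda K ^+ 2 <= delta / 4.
    move: s_ge; rewrite ler_pdivrMr // => s_ge.
    rewrite mulrAC ler_pdivrMr //.
    have := sqr_ge0 (statistical_dim lambda K); lra.
  by move: loss_mean; lra.
rewrite big_mkcond [leRHS]big_mkcond; apply: ler_sum => v _.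
case: ifP => lv; last by case: ifP => // _; case: pw.
rewrite ifT //; apply/asboolP; rewrite -Ac_y.
exact: sketched_pcg_accurate.
Qed.
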